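(* Let $n\ge1$ be an integer and let $x_1^*,\dots,x_n^*\in B_{\ell_1}$. Then there exists a closed subspace $W$ of $C(\Omega^n)$ of codimension $n$ such that (1) $W^*=\ell_1$ (isometrically); (2) under this identification, the limit points of the standard basis $\{e_j^*\}$ of $\ell_1$, with respect to the $\sigma(\ell_1,W)$-topology, are $x_1^*,\dots,x_n^*$.
   Context: All spaces are real. For an integer $n\ge1$ let $$\Omega^n=\left\{\left(\tfrac1i,\tfrac1j\right)\in\mathbb R^2: i=1,\dots,n,\ j=1,2,\dots\right\}\cup\left\{\left(\tfrac1i,0\right)\in\mathbb R^2:i=1,\dots,n\right\},$$ a compact subset of $\mathbb R^2$ with the Euclidean topology (homeomorphic to the ordinal interval $[1,\omega n]$). $C(\Omega^n)$ is the space of real-valued continuous functions on $\Omega^n$ with the supremum norm. $B_{\ell_1}$ is the closed unit ball of $\ell_1$. The statement $W^*=\ell_1$ means that there is a linear isometry of $W^*$ onto $\ell_1$, and $\sigma(\ell_1,W)$ is the weak$^*$ topology on $\ell_1$ induced by this identification. *)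

(* Defs.v *)
From HB Require Import structures.
From mathcomp Require Import all_boot all_order all_algebra.
From mathcomp Require Import all_classical all_reals all_analysis.

Set Implicit Arguments.
Unset Strict Implicit.
Unset Printing Implicit Defensive.

Import Order.TTheory GRing.Theory Num.Theory.
Import numFieldNormedType.Exports.

Local Open Scope classical_set_scope.
Local Open Scope ring_scope.

Section subspaces.
Variables (R : realType) (V : normedModType R) (W : submodClosed V).

Definition normed_sub := {v : V | v \in W}.

HB.instance Definition _ := SubType.on normed_sub.
HB.instance Definition _ := [Choice of normed_sub by <:].
HB.instance Definition _ := [SubChoice_isSubLmodule of normed_sub by <:].

Definition sub_norm (w : normed_sub) : R := `|\val w|.

Lemma sub_normD (v w : normed_sub) : sub_norm (v + w) <= sub_norm v + sub_norm w.
Proof. by rewrite /sub_norm raddfD ler_normD. Qed.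

Lemma sub_normZ (a : R) (v : normed_sub) : sub_norm (a *: v) = `|a| * sub_norm v.
Proof. by rewrite /sub_norm linearZ normrZ. Qed.

Lemma sub_norm0_eq0 (v : normed_sub) : sub_norm v = 0 -> v = 0.
Proof. by move=> /normr0_eq0 v0; apply: val_inj; rewrite v0 raddf0. Qed.

HB.instance Definition _ :=
  @Lmodule_isNormed.Build R normed_sub sub_norm sub_normD sub_normZ sub_norm0_eq0.

(* the cosets [b i + W] form a basis of the quotient space [V / W] *)
Definition has_codim (n : nat) := exists b : 'I_n -> V,
  forall v : V, exists! c : 'rV[R]_n, v - \sum_(i < n) c 0 i *: b i \in W.

End subspaces.

Section dual.
Variables (R : realType) (V : normedModType R).

Definition cont_linear : {pred V -> R} :=
  mem [set f : V -> R | linear f /\ continuous f].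

Lemma cont_linearP (f : V -> R) :
  f \in cont_linear <-> linear f /\ continuous f.
Proof. by rewrite /cont_linear; split; rewrite inE. Qed.

Lemma cont_linear_submod : submod_closed cont_linear.
Proof.
split.
  apply/cont_linearP; split=> [a u v|x]; last exact: cvg_cst.
  by rewrite /= scaler0 addr0.
move=> a f g /cont_linearP[lf cf] /cont_linearP[lg cg].
apply/cont_linearP; split=> [b u v|x].
  have fctE w : (a *: f + g) w = a *: f w + g w by [].
  by rewrite !fctE lf lg !scalerDr !scalerA (mulrC a b) addrACA.
by apply: cvgD; [apply: cvgZl_tmp; exact: cf | exact: cg].
Qed.

HB.instance Definition _ :=
  GRing.isSubmodClosed.Build R (V -> R) cont_linear cont_linear_submod.

Definition dual := {f : V -> R | f \in cont_linear}.

HB.instance Definition _ := SubType.on dual.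
HB.instance Definition _ := [Choice of dual by <:].
HB.instance Definition _ := [SubChoice_isSubLmodule of dual by <:].

Definition dual_fun (phi : dual) : V -> R := \val phi.
Coercion dual_fun : dual >-> Funclass.

Definition op_norm (phi : dual) : R := sup [set `|phi v| | v in [set v | `|v| <= 1]].

Lemma dual_linear (phi : dual) : linear phi.
Proof. by have /cont_linearP[] := valP phi. Qed.

Lemma dual_continuous (phi : dual) : continuous phi.
Proof. by have /cont_linearP[] := valP phi. Qed.
Arguments dual_continuous : clear implicits.

Lemma dual_scale (phi : dual) a v : phi (a *: v) = a * phi v.
Proof.
have d0 : phi 0 = 0.
  have := dual_linear phi 1 0 0; rewrite !scale1r addr0 => /eqP.
  by rewrite -subr_eq subrr => /eqP.
by have := dual_linear phi a v 0; rewrite !addr0 d0 addr0.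
Qed.

Lemma op_norm_has_sup (phi : dual) :
  has_sup [set `|phi v| | v in [set v | `|v| <= 1]].
Proof.
split; first by exists `|phi 0|; exists 0; rewrite /= ?normr0.
pose aux := GRing.isLinear.Build R V R *:%R phi (dual_linear phi).
pose f : {linear V -> R} := HB.pack (dual_fun phi) aux.
have /linear_boundedP : bounded_near f (nbhs 0).
  by apply: continuous_linear_bounded; exact: dual_continuous.
move=> /pinfty_ex_gt0[M M0 fM]; exists M => _ [v /= v1 <-].
by rewrite (le_trans (fM v))// ler_piMr// ltW.
Qed.

Lemma op_norm_ub (phi : dual) v : `|v| <= 1 -> `|phi v| <= op_norm phi.
Proof.
by move=> v1; apply: sup_upper_bound; [exact: op_norm_has_sup | exists v].
Qed.

Lemma op_norm_le (phi : dual) M :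
  (forall v, `|v| <= 1 -> `|phi v| <= M) -> op_norm phi <= M.
Proof.
move=> h; apply: ge_sup; first by have [] := op_norm_has_sup phi.
by move=> _ [v v1 <-]; exact: h.
Qed.

Lemma op_norm_ge0 (phi : dual) : 0 <= op_norm phi.
Proof. by apply: le_trans (op_norm_ub phi (v := 0) _); rewrite ?normr0. Qed.

Lemma op_normD (phi psi : dual) : op_norm (phi + psi) <= op_norm phi + op_norm psi.
Proof.
apply: op_norm_le => v v1.
by rewrite (le_trans (ler_normD _ _))// lerD// op_norm_ub.
Qed.

Lemma op_normZ (a : R) (phi : dual) : op_norm (a *: phi) = `|a| * op_norm phi.
Proof.
have le b (psi : dual) : op_norm (b *: psi) <= `|b| * op_norm psi.
  apply: op_norm_le => v v1.
  have -> : dual_fun (b *: psi) v = b * psi v by [].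
  by rewrite normrM ler_wpM2l// op_norm_ub.
apply/eqP; rewrite eq_le le /=.
have [->|a0] := eqVneq a 0; first by rewrite normr0 mul0r op_norm_ge0.
rewrite -ler_pdivlMl ?normr_gt0// -normfV.
by apply: le_trans (le _ _); rewrite scalerA mulVf// scale1r.
Qed.

Lemma op_norm0_eq0 (phi : dual) : op_norm phi = 0 -> phi = 0.
Proof.
move=> phi0; apply: val_inj; apply/funext => v.
have [->|v0] := eqVneq v 0.
  by have := dual_scale phi 0 0; rewrite scale0r mul0r.
have : `|phi (`|v|^-1 *: v)| <= op_norm phi.
  by apply: op_norm_ub; rewrite normrZ normfV normr_id mulVf ?normr_eq0.
rewrite phi0 normr_le0 dual_scale mulf_eq0 invr_eq0 normr_eq0 (negbTE v0) /=.
by move/eqP.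
Qed.

HB.instance Definition _ :=
  @Lmodule_isNormed.Build R dual op_norm op_normD op_normZ op_norm0_eq0.

End dual.

Section continuous_functions.
Variables (R : realType) (K : topologicalType) (cptK : compact [set: K]).

Definition cont_pred : {pred K -> R} := mem [set f : K -> R | continuous f].

Lemma cont_predP (f : K -> R) : f \in cont_pred <-> continuous f.
Proof. by rewrite /cont_pred; split; rewrite inE. Qed.

Lemma cont_pred_submod : submod_closed cont_pred.
Proof.
split; first by apply/cont_predP => x; exact: cvg_cst.
move=> a f g /cont_predP cf /cont_predP cg; apply/cont_predP => x.
by apply: cvgD; [apply: cvgZl_tmp; exact: cf | exact: cg].
Qed.

HB.instance Definition _ :=
  GRing.isSubmodClosed.Build R (K -> R) cont_pred cont_pred_submod.

(* The proof of compactness is a parameter so that the supremum norm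
   can be attached to the type. *)
Definition cont_space & compact [set: K] := {f : K -> R | f \in cont_pred}.

Notation C := (cont_space cptK).

HB.instance Definition _ := SubType.on C.
HB.instance Definition _ := [Choice of C by <:].
HB.instance Definition _ := [SubChoice_isSubLmodule of C by <:].

Definition cont_fun (f : C) : K -> R := \val f.
Coercion cont_fun : cont_space >-> Funclass.

Definition sup_norm (f : C) : R := sup [set `|f t| | t in [set: K]].

Lemma cont_continuous (f : C) : continuous f.
Proof. by have /cont_predP := valP f. Qed.
Arguments cont_continuous : clear implicits.

Lemma sup_norm_ub (f : C) t : `|f t| <= sup_norm f.
Proof.
apply: ub_le_sup; last by exists t.
have : compact [set `|f t| | t in [set: K]].
  apply: continuous_compact => //; apply: continuous_subspaceT => x.
  by apply: cvg_norm; exact: cont_continuous.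
by apply: (fun h1 h2 => (compact_has_sup h1 h2).2); exists `|f t|, t.
Qed.

Lemma sup_norm_ge0 (f : C) : 0 <= sup_norm f.
Proof.
have [[t _]|/set0P/negP/negPn/eqP K0] := pselect ([set: K] !=set0).
  by apply: le_trans (sup_norm_ub f t).
by rewrite /sup_norm K0 image_set0 sup0.
Qed.

Lemma sup_norm_le (f : C) M : 0 <= M -> (forall t, `|f t| <= M) -> sup_norm f <= M.
Proof.
move=> M0 h.
have [[t _]|/set0P/negP/negPn/eqP K0] := pselect ([set: K] !=set0).
  by apply: ge_sup; [exists `|f t|, t | move=> _ [s _ <-]].
by rewrite /sup_norm K0 image_set0 sup0.
Qed.

Lemma sup_normD (f g : C) : sup_norm (f + g) <= sup_norm f + sup_norm g.
Proof.
apply: sup_norm_le => [|t]; first by rewrite addr_ge0 ?sup_norm_ge0.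
by rewrite (le_trans (ler_normD _ _))// lerD// sup_norm_ub.
Qed.

Lemma sup_normZ (a : R) (f : C) : sup_norm (a *: f) = `|a| * sup_norm f.
Proof.
have le b (g : C) : sup_norm (b *: g) <= `|b| * sup_norm g.
  apply: sup_norm_le => [|t]; first by rewrite mulr_ge0 ?sup_norm_ge0.
  have -> : cont_fun (b *: g) t = b * g t by [].
  by rewrite normrM ler_wpM2l// sup_norm_ub.
apply/eqP; rewrite eq_le le /=.
have [->|a0] := eqVneq a 0; first by rewrite normr0 mul0r sup_norm_ge0.
rewrite -ler_pdivlMl ?normr_gt0// -normfV.
by apply: le_trans (le _ _); rewrite scalerA mulVf// scale1r.
Qed.

Lemma sup_norm0_eq0 (f : C) : sup_norm f = 0 -> f = 0.
Proof.
move=> f0; apply: val_inj; apply/funext => t.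
by apply/eqP; rewrite -normr_le0 -f0 sup_norm_ub.
Qed.

HB.instance Definition _ :=
  @Lmodule_isNormed.Build R C sup_norm sup_normD sup_normZ sup_norm0_eq0.

End continuous_functions.

Section l1.
Variable R : realType.

Definition summable_pred : {pred nat -> R} :=
  mem [set a : nat -> R | cvgn [normed series a]].

Lemma summable_predP (a : nat -> R) :
  a \in summable_pred <-> cvgn [normed series a].
Proof. by rewrite /summable_pred; split; rewrite inE. Qed.

Lemma normed_seriesE (a : nat -> R) k :
  [normed series a] k = \sum_(0 <= i < k) `|a i|.
Proof. by []. Qed.

Lemma normed_series_le (a b c : nat -> R) : cvgn [normed series b] ->
  cvgn [normed series c] -> (forall k, `|a k| <= `|b k| + `|c k|) ->
  cvgn [normed series a].
Proof.
move=> sb sc h; have := is_cvg_seriesD sb sc.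
apply: series_le_cvg => // k; first exact: normr_ge0.
exact: le_trans (normr_ge0 (a k)) (h k).
Qed.

Lemma normed_seriesZ (x : R) (a : nat -> R) :
  [normed series (x *: a)] = series (`|x| *: (fun k => `|a k|)).
Proof. by congr series; apply/funext => k; rewrite /= normrM. Qed.

Lemma normed_series_cvgZ (x : R) (a : nat -> R) :
  cvgn [normed series a] -> cvgn [normed series (x *: a)].
Proof. by move=> sa; rewrite normed_seriesZ; exact: is_cvg_seriesZ. Qed.

Lemma summable_submod : submod_closed summable_pred.
Proof.
split.
  apply/summable_predP; apply: (cvgP (0 : R)); apply: cvg_near_cst.
  by apply: nearW => k; rewrite !normed_seriesE big1// => i _; rewrite normr0.
move=> x a b /summable_predP sa /summable_predP sb; apply/summable_predP.
apply: (normed_series_le (normed_series_cvgZ (x := x) sa) sb) => k.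
exact: ler_normD.
Qed.

HB.instance Definition _ :=
  GRing.isSubmodClosed.Build R (nat -> R) summable_pred summable_submod.

Definition l1 := {a : nat -> R | a \in summable_pred}.

HB.instance Definition _ := SubType.on l1.
HB.instance Definition _ := [Choice of l1 by <:].
HB.instance Definition _ := [SubChoice_isSubLmodule of l1 by <:].

Definition l1_seq (a : l1) : nat -> R := \val a.
Coercion l1_seq : l1 >-> Funclass.

Definition l1_norm (a : l1) : R := limn [normed series a].

Lemma l1_summable (a : l1) : cvgn [normed series a].
Proof. by have /summable_predP := valP a. Qed.
Arguments l1_summable : clear implicits.

Lemma l1_normD (a b : l1) : l1_norm (a + b) <= l1_norm a + l1_norm b.
Proof.
rewrite /l1_norm -lim_seriesD; try exact: l1_summable.
apply: lim_series_le; first exact: (l1_summable (a + b)).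
  by apply: is_cvg_seriesD; exact: l1_summable.
by move=> k; exact: ler_normD.
Qed.

Lemma l1_normZ (x : R) (a : l1) : l1_norm (x *: a) = `|x| * l1_norm a.
Proof.
by rewrite /l1_norm [X in limn X]normed_seriesZ lim_seriesZ//; exact: l1_summable.
Qed.

Lemma l1_norm0_eq0 (a : l1) : l1_norm a = 0 -> a = 0.
Proof.
move=> a0; apply: val_inj; apply/funext => k.
have nd : nondecreasing_seq [normed series a].
  by apply/nondecreasing_seqP => n; rewrite !normed_seriesE big_nat_recr//= lerDl.
have := nondecreasing_cvgn_le nd (l1_summable a) k.+1.
rewrite -/(l1_norm a) a0 normed_seriesE big_nat_recr//= => h.
apply/eqP; rewrite -normr_le0; apply: le_trans h.
by rewrite lerDr sumr_ge0.
Qed.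

HB.instance Definition _ :=
  @Lmodule_isNormed.Build R l1 l1_norm l1_normD l1_normZ l1_norm0_eq0.

Lemma l1_basis_summable (j : nat) :
  (fun k => (k == j)%:R : R) \in summable_pred.
Proof.
apply/summable_predP; apply: (cvgP (1 : R)); apply: cvg_near_cst.
exists j.+1 => // n jn; apply: etrans (normed_seriesE _ n) _.
rewrite big_mkord (bigD1 (Ordinal jn))//= eqxx normr1 big1 ?addr0// => i.
by rewrite -val_eqE/= => /negbTE ->; rewrite normr0.
Qed.

Definition l1_basis (j : nat) : l1 :=
  exist _ (fun k : nat => (k == j)%:R) (l1_basis_summable j).

End l1.

Section weak_star.
Variables (R : realType) (V : normedModType R).

(* [J] is the identification of l_1 with the dual of [V]; [sigma_l1 J] is the
   topology of pointwise convergence on [V] of the functionals [J a]. *)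
Definition sigma_l1 & l1 R -> dual V : Type := l1 R.

Definition pairing (J : l1 R -> dual V) (a : l1 R) : {ptws V -> R} :=
  fun v => J a v.

HB.instance Definition _ (J : l1 R -> dual V) :=
  Topological.copy (sigma_l1 J) (initial_topology (pairing J)).

End weak_star.

Section Omega.
Variables (R : realType) (n : nat).

Definition Omega : set (R * R) :=
  [set p | exists i j : nat, [/\ (1 <= i <= n)%N, (1 <= j)%N
                              & p = (i%:R^-1, j%:R^-1)]]
  `|` [set p | exists2 i : nat, (1 <= i <= n)%N & p = (i%:R^-1, 0)].

Lemma cvg_range_compact (u : nat -> R) (l : R) :
  u @ \oo --> l -> compact (range u `|` [set l]).
Proof.
move=> ul F PF FA.
have [clF|] := pselect (cluster F l); first by exists l; split => //; right.
move=> /existsNP[B /existsNP[U /not_implyP[FB /not_implyP[lU BU]]]].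
have [N _ uN] : \forall k \near \oo, U (u k) by exact: ul.
have FS : F (u @` `I_N).
  apply: filterS (filterI FA FB) => y [[[k _ <-]|->] Bk].
    have [kN|Nk] := ltnP k N; first by exists k.
    by exfalso; apply: BU; exists (u k); split => //; exact: uN.
  by exfalso; apply: BU; exists l; split => //; exact: nbhs_singleton.
have [p [[k _ <-] clp]] : (u @` `I_N) `&` cluster F !=set0.
  by apply: finite_compact => //; exact: finite_image.
by exists (u k); split => //; left; exists k.
Qed.

Lemma set_type_compact (T : topologicalType) (A : set T) :
  compact A -> compact [set: A].
Proof.
move=> cA F PF _.
have FA : (set_val @ F) A.
  apply: (@filterS _ F _ setT) => [x _|]; last exact: filterT.
  exact: set_valP.
have [p [Ap clp]] := cA _ _ FA.
exists (exist _ p (mem_set Ap)); split => // B U FB [V [[V' oV' <-] /= V'p VU]].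
have FsB : (set_val @ F) (set_val @` B).
  by apply: (@filterS _ F _ B) => [x Bx|//]; exists x.
have pV' : nbhs p V' by apply: open_nbhs_nbhs.
have [_ [[x Bx <-] V'x]] := clp _ _ FsB pV'.
by exists x; split => //; exact: VU.
Qed.

Lemma compact_Omega : compact [set: Omega].
Proof.
apply: set_type_compact.
pose A := (fun i : nat => i.+1%:R^-1 : R) @` `I_n.
have cA : compact A by apply: finite_compact; exact: finite_image.
have -> : Omega = A `*` (range (@harmonic R) `|` [set 0]).
  apply/seteqP; split => [p|[x y] [/= [i ni <-]]].
    case=> [[[|i] [[|j] [// ni // _ ->]]]|[[|i] // ni ->]].
      by split; [exists i | left; exists j].
    by split; [exists i | right].
  case=> [[j _ <-]|->]; first by left; exists i.+1, j.+1.
  by right; exists i.+1.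
by apply: compact_setX => //; apply: cvg_range_compact; exact: cvg_harmonic.
Qed.

End Omega.

Arguments Omega : clear implicits.

Notation C_Omega R n := (cont_space R (@compact_Omega R n)).

(* Main.v *)
From HB Require Import structures.
Require Import Defs.
From mathcomp Require Import all_boot all_order all_algebra.
From mathcomp Require Import all_classical all_reals all_analysis.
From mathcomp Require Import ring lra.

Set Implicit Arguments.
Unset Strict Implicit.
Unset Printing Implicit Defensive.

Import Order.TTheory GRing.Theory Num.Theory.
Import numFieldNormedType.Exports.

Local Open Scope classical_set_scope.
Local Open Scope ring_scope.

(** Let [q_k] ([Omega_pt k]) enumerate the isolated points of Omega^n, with [q_k] in
    column [k mod n], and let [p_i] ([Omega_lim i]) be the limit of the [i]-th
    column. Take
    [W = {f | f (p_i) = sum_k x_i(k) f (q_k) for all i}]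
    and let [a] in l_1 act on [W] by [f |-> sum_k a_k f (q_k)]. Then [e_k] acts as
    evaluation at [q_k] and [x_i] as evaluation at [p_i], so the [e_k] with [k] in
    column [i] converge to [x_i].

    The norm of [a] is attained in the limit by functions of [W] with prescribed
    values in the unit interval at [q_k], [k < N], and a constant value [w_i] on the
    rest of column [i]: such a function is in [W] iff [w] solves a fixed point
    equation whose linear part has row sums bounded by the tails
    [sum_(k >= N) |x_i(k)|], hence is a contraction for large [N], and
    [|x_i| <= 1] forces [|w_i| <= 1]. The same linear system gives the codimension
    and a bounded projection of C(Omega^n) onto [W]. Through this projection a
    functional on [W] extends to C(Omega^n), where it has the form
    [sum_k a_k f (q_k) + sum_i b_i f (p_i)]; on [W] this is the action of
    [a + sum_i b_i x_i]. *)

Lemma bounded_functional_continuous (R : realType) (V : normedModType R)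
    (f : {linear V -> R}) (B : R) :
  (forall v, `|f v| <= B * `|v|) -> continuous f.
Proof.
move=> fB; apply/bounded_linear_continuous/linear_boundedP.
near=> r => v; apply: le_trans (fB v) _; rewrite ler_wpM2r//.
Unshelve. all: by end_near. Qed.

(** * Pairing l_1 with bounded sequences *)

Section pairing.
Variable R : realType.
Implicit Types (a b : l1 R) (s t : nat -> R).

Definition l1_pair a s : R := limn (series (fun k => a k * s k)).

(** The tail [sum_(k >= N) |a_k|], written as a difference so that it needs no further limit. *)
Definition l1_tail a N : R := `|a| - \sum_(0 <= k < N) `|a k|.

Lemma l1_normE a : `|a| = limn [normed series a]. Proof. by []. Qed.

Lemma l1_pair_ncvg a s M : (forall k, `|s k| <= M) ->
  cvgn [normed series (fun k => a k * s k)].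
Proof.
move=> sM; apply: (@series_le_cvg _ _ (fun k => M * `|a k|)).
- by move=> k; exact: normr_ge0.
- by move=> k; rewrite mulr_ge0// (le_trans _ (sM 0%N)).
- by move=> k /=; rewrite normrM mulrC ler_wpM2r.
- have := @is_cvg_seriesZ _ _ M (l1_summable (a := a)); exact.
Qed.

Lemma l1_pair_cvg a s M : (forall k, `|s k| <= M) ->
  cvgn (series (fun k => a k * s k)).
Proof. by move=> sM; apply: normed_cvg; exact: l1_pair_ncvg sM. Qed.

Lemma l1_pairDl a b s M : (forall k, `|s k| <= M) ->
  l1_pair (a + b) s = l1_pair a s + l1_pair b s.
Proof.
move=> sM; rewrite /l1_pair -lim_seriesD; try exact: l1_pair_cvg sM.
by congr (limn (series _)); apply/funext => k; rewrite -mulrDl.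
Qed.

Lemma l1_pairZl c a s M : (forall k, `|s k| <= M) ->
  l1_pair (c *: a) s = c * l1_pair a s.
Proof.
move=> sM; rewrite /l1_pair -[RHS]lim_seriesZ; last exact: l1_pair_cvg sM.
by congr (limn (series _)); apply/funext => k; exact: (esym (mulrA _ _ _)).
Qed.

Lemma l1_pairDr a s t M M' : (forall k, `|s k| <= M) -> (forall k, `|t k| <= M') ->
  l1_pair a (s + t) = l1_pair a s + l1_pair a t.
Proof.
move=> sM tM; rewrite /l1_pair -lim_seriesD;
  [|exact: l1_pair_cvg sM|exact: l1_pair_cvg tM].
by congr (limn (series _)); apply/funext => k; rewrite -mulrDr.
Qed.

Lemma l1_pairZr c a s M : (forall k, `|s k| <= M) ->
  l1_pair a (c *: s) = c * l1_pair a s.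
Proof.
move=> sM; rewrite /l1_pair -[RHS]lim_seriesZ; last exact: l1_pair_cvg sM.
by congr (limn (series _)); apply/funext => k; rewrite /= mulrCA.
Qed.

Lemma l1_basisE j k : l1_basis R j k = (k == j)%:R. Proof. by []. Qed.

Lemma l1_pair_single a s j : (forall k, k != j -> a k * s k = 0) ->
  l1_pair a s = a j * s j.
Proof.
move=> as0; apply/cvg_lim => //; apply: cvg_near_cst; exists j.+1 => // m jm.
rewrite /series/= big_mkord (bigD1 (Ordinal jm))//= big1 ?addr0// => i.
by rewrite -val_eqE => /as0.
Qed.

Lemma l1_pair_basis j s : l1_pair (l1_basis R j) s = s j.
Proof.
rewrite (@l1_pair_single _ _ j) ?l1_basisE ?eqxx ?mul1r// => k /negbTE kj.
by rewrite l1_basisE kj mul0r.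
Qed.

Lemma l1_tail_cvg0 a : l1_tail a @ \oo --> (0 : R).
Proof.
rewrite -[X in _ --> X](subrr `|a|); apply: cvgB; first exact: cvg_cst.
exact: (l1_summable (a := a)).
Qed.

Lemma l1_tail_ge0 a N : 0 <= l1_tail a N.
Proof.
rewrite subr_ge0 l1_normE; apply: (nondecreasing_cvgn_le _ (l1_summable (a := a)) N).
by apply/nondecreasing_seqP => m; rewrite !normed_seriesE big_nat_recr//= lerDl.
Qed.

(** Separate bounds on the head and the tail of [s]. The contraction estimate in [step_le] and the
    lower bound for the dual norm in [l1_dual_norm] both rest on this. *)
Lemma l1_pair_split a s m M N : (forall k, (k < N)%N -> `|s k| <= m) ->
  (forall k, (N <= k)%N -> `|s k| <= M) ->
  `|l1_pair a s| <= m * (\sum_(0 <= k < N) `|a k|) + M * l1_tail a N.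
Proof.
move=> sm sM.
have sb k : `|s k| <= Num.max m M.
  by rewrite le_max; case: (ltnP k N) => [/sm ->//|/sM ->]; rewrite orbT.
apply: le_trans (lim_series_norm (l1_pair_ncvg (a := a) sb)) _.
(* In this form the bound is the limit in [K] of bounds for the partial sums up to [K], valid from
   [K = N] on. *)
have -> : m * (\sum_(0 <= k < N) `|a k|) + M * l1_tail a N =
   (m - M) * (\sum_(0 <= k < N) `|a k|) + M * `|a| by rewrite /l1_tail; ring.
have /cvg_lim <- // :
  (m - M) * (\sum_(0 <= k < N) `|a k|) + M * [normed series a] K @[K --> \oo] -->
  (m - M) * (\sum_(0 <= k < N) `|a k|) + M * `|a|.
  by apply: cvgD; [exact: cvg_cst|apply: cvgMl_tmp; exact: (l1_summable (a := a))].
apply: ler_lim.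
- exact: l1_pair_ncvg sb.
- apply: is_cvgD; [exact: is_cvg_cst|].
  by apply: is_cvgMl_tmp; exact: (l1_summable (a := a)).
exists N => // K /= NK.
rewrite /series /= (@big_cat_nat _ _ _ N)//=
  [X in _ <= _ + _ * X](@big_cat_nat _ _ _ N)//=.
rewrite mulrDr addrA -mulrDl subrK.
apply: lerD; rewrite mulr_sumr; apply: ler_sum_nat => k /andP[k1 k2];
  rewrite normrM mulrC ler_wpM2r//.
  exact: sm.
exact: sM.
Qed.

Lemma l1_pair_le a s M : (forall k, `|s k| <= M) -> `|l1_pair a s| <= M * `|a|.
Proof.
move=> sM; have := @l1_pair_split a s M M 0%N (fun k _ => sM k) (fun k _ => sM k).
by rewrite /l1_tail big_geq// mulr0 add0r subr0.
Qed.

Lemma l1_pair_sg a : l1_pair a (fun k => Num.sg (a k)) = `|a|.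
Proof.
by congr (limn (series _)); apply/funext => k; rewrite mulrC -normrEsg.
Qed.

End pairing.

(** * The points of Omega^n and their neighbourhoods *)

Section Omega_points.
Variables (R : realType) (n : nat).
Local Notation Om := (Omega R n.+1).

Definition Omega_col (k : nat) : 'I_n.+1 := Ordinal (ltn_pmod k (ltn0Sn n)).

(** Inverse to [k |-> (k mod n.+1, k / n.+1)], that is, to column and height. There are [n.+1]
    columns, so the variable [n] is one less than the n of the theorem. *)
Definition Omega_idx (i : 'I_n.+1) (j : nat) : nat := j * n.+1 + i.

Lemma Omega_col_idx i j : Omega_col (Omega_idx i j) = i.
Proof. by apply: val_inj; rewrite /= modnMDl modn_small. Qed.

Lemma Omega_idx_div i j : (Omega_idx i j %/ n.+1 = j)%N.
Proof. by rewrite divnMDl// divn_small// addn0. Qed.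

Lemma Omega_idx_col k : Omega_idx (Omega_col k) (k %/ n.+1) = k.
Proof. by rewrite /Omega_idx/= -divn_eq. Qed.

Lemma Omega_idx_ge i j : (j <= Omega_idx i j)%N.
Proof. by rewrite (leq_trans (leq_pmulr j (ltn0Sn n)))// leq_addr. Qed.

Lemma Omega_pt_subproof k :
  ((Omega_col k).+1%:R^-1 : R, (k %/ n.+1).+1%:R^-1 : R) \in Om.
Proof.
apply/mem_set; left; exists (Omega_col k).+1, (k %/ n.+1).+1.
by split => //=; rewrite ltn_pmod.
Qed.

Definition Omega_pt k : Om :=
  @exist (R * R) (fun p => p \in Om) _ (Omega_pt_subproof k).

Lemma Omega_lim_subproof (i : 'I_n.+1) : (i.+1%:R^-1 : R, 0 : R) \in Om.
Proof. by apply/mem_set; right; exists i.+1 => //=. Qed.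

Definition Omega_lim i : Om :=
  @exist (R * R) (fun p => p \in Om) _ (Omega_lim_subproof i).

Variant Omega_spec : Om -> Prop :=
  | OmegaPt k : Omega_spec (Omega_pt k)
  | OmegaLim i : Omega_spec (Omega_lim i).

Lemma OmegaP t : Omega_spec t.
Proof.
case: t => p pO; have := set_mem pO.
case=> [[[|i] [[|j] [// ni // _ pE]]]|[[|i] // ni pE]].
  have -> : exist _ p pO = Omega_pt (Omega_idx (Ordinal ni) j).
    by apply: val_inj; rewrite /= Omega_idx_div modnMDl modn_small.
  exact: OmegaPt.
have -> : exist _ p pO = Omega_lim (Ordinal ni) by apply: val_inj.
exact: OmegaLim.
Qed.

Lemma Omega_fst_cvg (t : Om) : (fun s : Om => (val s).1) @ t --> (val t).1.
Proof.
apply: (@cvg_comp _ _ _ (set_val : Om -> R * R) fst _ (nbhs (val t))); last first.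
  by case: (val t) => a b; exact: cvg_fst.
exact: initial_continuous.
Qed.

Lemma Omega_snd_cvg (t : Om) : (fun s : Om => (val s).2) @ t --> (val t).2.
Proof.
apply: (@cvg_comp _ _ _ (set_val : Om -> R * R) snd _ (nbhs (val t))); last first.
  by case: (val t) => a b; exact: cvg_snd.
exact: initial_continuous.
Qed.

(** Inversion is continuous near [f t != 0] and turns reciprocals into integers; integers at
    distance less than 1 coincide. *)
Lemma near_inv_nat (T : topologicalType) (f : T -> R) (t : T) (m : nat) :
  f @ t --> f t -> f t = m.+1%:R^-1 ->
  \forall s \near t, forall k : nat, f s = k.+1%:R^-1 -> k = m.
Proof.
move=> fc ft.
have fVc : (fun s => (f s)^-1) @ t --> (f t)^-1 by apply: cvgV => //; rewrite ft.
have /cvgrPdist_lt/(_ _ ltr01) := fVc.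
apply: filterS => s + k sk; rewrite ft sk !invrK ltr_norml => /andP[h h'].
have h1 : m.+1%:R - 1 < k.+1%:R :> R by lra.
have h2 : k.+1%:R - 1 < m.+1%:R :> R by lra.
move: h1 h2; rewrite !mulrSr !addrK -!mulrSr !ltr_nat !ltnS => h1 h2.
by apply/eqP; rewrite eqn_leq h1 h2.
Qed.

(** Each coordinate determines its integer by [near_inv_nat], and the limits are excluded because
    their second coordinate is 0. *)
Lemma Omega_near_pt k : \forall s \near Omega_pt k, s = Omega_pt k.
Proof.
have h1 := near_inv_nat (Omega_fst_cvg (t := Omega_pt k)) (erefl _).
have h2 := near_inv_nat (Omega_snd_cvg (t := Omega_pt k)) (erefl _).
have h3 : \forall s \near Omega_pt k, 0 < (val s).2.
  by apply: (cvgr_gt _ (Omega_snd_cvg (t := Omega_pt k))); rewrite /= invr_gt0.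
apply: filterS (filterI (filterI h1 h2) h3) => s; have [l|i] := OmegaP s; last first.
  by move=> [_]; rewrite /= ltxx.
move=> [[/(_ _ erefl) lk1 /(_ _ erefl) lk2] _]; congr Omega_pt.
by rewrite (divn_eq l n.+1) (divn_eq k n.+1) lk2; congr (_ + _)%N; exact: lk1.
Qed.

Lemma Omega_near_lim i N : \forall s \near Omega_lim i,
  s = Omega_lim i \/ exists2 j, (N <= j)%N & s = Omega_pt (Omega_idx i j).
Proof.
have h1 := near_inv_nat (Omega_fst_cvg (t := Omega_lim i)) (erefl _).
have h2 : \forall s \near Omega_lim i, (val s).2 < N.+1%:R^-1.
  by apply: (cvgr_lt _ (Omega_snd_cvg (t := Omega_lim i))); rewrite /= invr_gt0.
apply: filterS (filterI h1 h2) => s; have [k|i'] := OmegaP s.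
  move=> [/(_ _ erefl) ki kN]; right; exists (k %/ n.+1)%N.
    by move: kN; rewrite /= ltf_pV2 ?posrE// ltr_nat ltnS; exact: ltnW.
  by congr Omega_pt; rewrite -[LHS]Omega_idx_col; congr Omega_idx; exact: val_inj.
by move=> [/(_ _ erefl) ii' _]; left; congr Omega_lim; exact: val_inj.
Qed.

(* [s] and [l] give the values at the isolated points and at the limits; the
   indices of [t] are read off the inverses of its coordinates. *)
Definition Omega_fun (s : nat -> R) (l : 'I_n.+1 -> R) (t : Om) : R :=
  let i := inord (Num.truncn (val t).1^-1).-1 in
  if (val t).2 == 0 then l i else s (Omega_idx i (Num.truncn (val t).2^-1).-1).

Lemma Omega_fun_pt s l k : Omega_fun s l (Omega_pt k) = s k.
Proof.
rewrite /Omega_fun /= invr_eq0 pnatr_eq0 /= !invrK !natrK /=.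
rewrite (_ : inord _ = Omega_col k) ?Omega_idx_col//.
by apply: val_inj; rewrite /= inordK// ltn_pmod.
Qed.

Lemma Omega_fun_lim s l i : Omega_fun s l (Omega_lim i) = l i.
Proof. by rewrite /Omega_fun /= eqxx invrK natrK /= inord_val. Qed.

Lemma Omega_fun_continuous s l :
  (forall i, s \o Omega_idx i @ \oo --> l i) -> continuous (Omega_fun s l).
Proof.
move=> sl t; have [k|i] := OmegaP t.
  move=> A /nbhs_singleton sA.
  by apply: (@filterS _ (nbhs (Omega_pt k)) _ _ _ _ (Omega_near_pt k)) => r ->.
move=> A; rewrite Omega_fun_lim => lA.
have [N _ NA] := sl i _ lA.
apply: (@filterS _ (nbhs (Omega_lim i)) _ _ _ _ (Omega_near_lim i N)).
move=> r [->|[j Nj ->]] /=.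
  by rewrite Omega_fun_lim; exact: nbhs_singleton.
by rewrite Omega_fun_pt; exact: NA.
Qed.

Lemma Omega_idx_cvg i : Omega_pt \o Omega_idx i @ \oo --> Omega_lim i.
Proof.
move=> A [_ [[B oB <-] Bi] BA].
have c : (i.+1%:R^-1 : R, @harmonic R j) @[j --> \oo] --> (i.+1%:R^-1 : R, 0 : R).
  exact: (cvg_pair (G := nbhs (i.+1%:R^-1 : R)) (H := nbhs (0 : R))
    (@cvg_cst _ _ _ _ _) (@cvg_harmonic R)).
have /c [N _ NB] : nbhs (i.+1%:R^-1 : R, 0 : R) B by exact: open_nbhs_nbhs.
exists N => // j Nj.
suff : (set_val @^-1` B) (Omega_pt (Omega_idx i j)) by exact: BA.
have := NB _ Nj; rewrite /preimage/= /harmonic.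
by rewrite set_valE /= Omega_idx_div modnMDl modn_small.
Qed.

End Omega_points.

(** * Functions on Omega^n, step functions and bounded functionals *)

Section cont_Omega.
Variables (R : realType) (n : nat).
Local Notation C := (C_Omega R n.+1).
Local Notation pt := (Omega_pt R n).
Local Notation lm := (@Omega_lim R n).
Implicit Types (f g : C) (c : nat -> R) (w : 'rV[R]_n.+1).

Lemma cont_spaceDE f g t : (f + g : C) t = f t + g t. Proof. by []. Qed.
Lemma cont_spaceBE f g t : (f - g : C) t = f t - g t. Proof. by []. Qed.
Lemma cont_spaceZE a f t : (a *: f : C) t = a * f t. Proof. by []. Qed.

Lemma cont_Omega_cvg f i :
  (fun j => f (pt (Omega_idx i j))) @ \oo --> f (lm i).
Proof.
exact: (cvg_comp _ _ (@Omega_idx_cvg R n i) (cont_continuous (f := f) (x := _))).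
Qed.

(** The isolated points are dense. *)
Lemma cont_Omega_norm_le f (M : R) : (forall k, `|f (pt k)| <= M) -> `|f| <= M.
Proof.
move=> fM; apply: sup_norm_le => [|t]; first exact: le_trans (fM 0%N).
have [k|i] := OmegaP t => //.
by apply: (cvgr_to_le (cvg_norm (@cont_Omega_cvg f i))); exact: nearW.
Qed.

Lemma cont_Omega_eq f g : (forall k, f (pt k) = g (pt k)) -> f = g.
Proof.
move=> fg; apply/eqP; rewrite -subr_eq0 -normr_le0.
by apply: cont_Omega_norm_le => k; rewrite cont_spaceBE fg subrr normr0.
Qed.

(** Finitely many columns converge uniformly, and an index [k >= J * n.+1] has height at least [J]
    in its column. *)
Lemma cont_Omega_near f e : 0 < e ->
  \forall K \near \oo, forall k, (K <= k)%N ->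
    `|f (pt k) - f (lm (Omega_col n k))| <= e.
Proof.
move=> e0.
have : \forall j \near \oo, forall i,
    `|f (pt (Omega_idx i j)) - f (lm i)| <= e.
  by apply: filter_forall => i; exact: (cvgr_distC_le _ _ (@cont_Omega_cvg f i)).
move=> [J _ JP]; exists (J * n.+1)%N => // K /= JK k Kk.
have /JP/(_ (Omega_col n k)) : (J <= k %/ n.+1)%N.
  by rewrite leq_divRL// (leq_trans JK).
by rewrite Omega_idx_col.
Qed.

Lemma Omega_step_subproof N c w :
  Omega_fun (fun k => if (k < N)%N then c k else w 0 (Omega_col n k)) (w 0)
    \in @cont_pred R (Omega R n.+1).
Proof.
apply/cont_predP/Omega_fun_continuous => i; apply: cvg_near_cst.
exists N => // j /= Nj; rewrite Omega_col_idx ltnNge.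
by rewrite (leq_trans Nj) ?Omega_idx_ge.
Qed.

(** The tail values form a row vector, so that the equations defining W become a matrix equation in
    [w]. *)
Definition Omega_step N c w : C :=
  exist (fun h => h \in @cont_pred R (Omega R n.+1)) _ (Omega_step_subproof N c w).

Lemma Omega_step_pt N c w k : Omega_step N c w (pt k) =
  if (k < N)%N then c k else w 0 (Omega_col n k).
Proof. exact: Omega_fun_pt. Qed.

Lemma Omega_step_lim N c w i : Omega_step N c w (lm i) = w 0 i.
Proof. exact: Omega_fun_lim. Qed.

Lemma Omega_step_cvg f :
  Omega_step N (f \o pt) (\row_i f (lm i)) @[N --> \oo] --> f.
Proof.
apply/cvgrPdist_le => e e0; have [K _ fK] := cont_Omega_near f e0.
exists K => // N KN; apply: cont_Omega_norm_le => k.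
rewrite cont_spaceBE Omega_step_pt mxE.
by case: ltnP => [_|/(fK _ KN)//]; rewrite subrr normr0 ltW.
Qed.

Definition Omega_tail N w := Omega_step N (fun=> 0) w.

Lemma Omega_tail_linear N : linear (Omega_tail N).
Proof.
move=> a u v; apply: cont_Omega_eq => k.
rewrite cont_spaceDE cont_spaceZE !Omega_step_pt !mxE.
by case: ifP => // _; rewrite mulr0 addr0.
Qed.

HB.instance Definition _ N :=
  GRing.isLinear.Build R 'rV[R]_n.+1 C *:%R (Omega_tail N) (Omega_tail_linear N).

Lemma Omega_step_tail N c w :
  Omega_step N c w = Omega_step N c 0 + Omega_tail N w.
Proof.
apply: cont_Omega_eq => k; rewrite cont_spaceDE !Omega_step_pt mxE.
by case: ifP; rewrite (addr0,add0r).
Qed.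

(** The indicator function of the isolated point q_k. *)
Definition Omega_delta k := Omega_step k.+1 (fun j => (j == k)%:R) 0.

Lemma Omega_stepS N c :
  Omega_step N.+1 c 0 = Omega_step N c 0 + c N *: Omega_delta N.
Proof.
apply: cont_Omega_eq => k.
rewrite cont_spaceDE cont_spaceZE !Omega_step_pt mxE ltnS.
by case: ltngtP => [kN|kN|->]; rewrite ?(mulr1,mulr0,addr0,add0r).
Qed.

Lemma Omega_step_sum (psi : {linear C -> R}) N c :
  psi (Omega_step N c 0) = \sum_(0 <= k < N) psi (Omega_delta k) * c k.
Proof.
elim: N => [|N IH].
  rewrite big_geq// (_ : Omega_step _ _ _ = 0) ?linear0//.
  by apply: cont_Omega_eq => k; rewrite Omega_step_pt mxE.
by rewrite big_nat_recr//= -IH Omega_stepS linearD linearZ mulrC.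
Qed.

Definition Omega_pair (a : l1 R) f : R := l1_pair a (fun k => f (pt k)).

Lemma Omega_pair_linear a : linear (Omega_pair a).
Proof.
move=> b f g; have bd (h : C) k : `|h (pt k)| <= `|h| := sup_norm_ub h (pt k).
apply: etrans (l1_pairDr a (bd (b *: f)) (bd g)) _.
by congr (_ + _); exact: (l1_pairZr b a (bd f)).
Qed.

HB.instance Definition _ a :=
  GRing.isLinear.Build R C R *:%R (Omega_pair a) (Omega_pair_linear a).

Lemma Omega_pairDl a b f : Omega_pair (a + b) f = Omega_pair a f + Omega_pair b f.
Proof. by apply: (l1_pairDl a b (M := `|f|)) => k; exact: sup_norm_ub. Qed.

Lemma Omega_pairZl r a f : Omega_pair (r *: a) f = r * Omega_pair a f.
Proof. by apply: (l1_pairZl r a (M := `|f|)) => k; exact: sup_norm_ub. Qed.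

Lemma Omega_pair_suml (I : finType) (b : I -> R) (a : I -> l1 R) f :
  Omega_pair (\sum_i b i *: a i) f = \sum_i b i * Omega_pair (a i) f.
Proof.
have lin : linear (fun d : l1 R => Omega_pair d f : R).
  by move=> r d d'; rewrite Omega_pairDl Omega_pairZl.
pose p : {linear l1 R -> R} := HB.pack (fun d : l1 R => Omega_pair d f : R)
  (GRing.isLinear.Build R (l1 R) R *:%R _ lin).
apply: etrans (linear_sum p _ _ _) _; apply: eq_bigr => i _.
exact: (linearZ_LR p).
Qed.

Lemma Omega_pair_le a f : `|Omega_pair a f| <= `|a| * `|f|.
Proof. by rewrite mulrC; apply: l1_pair_le => k; exact: sup_norm_ub. Qed.

Lemma Omega_pair_basis k f : Omega_pair (l1_basis R k) f = f (pt k).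
Proof. exact: l1_pair_basis. Qed.

(** The weight at an isolated point is the value of [psi] on its indicator; the remainder factors
    through the vector of limits, a finite-dimensional space. *)
Lemma cont_Omega_riesz (psi : {linear C -> R}) B : 0 <= B ->
  (forall f, `|psi f| <= B * `|f|) ->
  exists (a : l1 R) (b : 'I_n.+1 -> R),
    forall f, psi f = Omega_pair a f + \sum_i f (lm i) * b i.
Proof.
move=> B0 psiB.
have sa : (fun k => psi (Omega_delta k)) \in @summable_pred R.
  apply/summable_predP; apply: nondecreasing_is_cvgn.
    by apply/nondecreasing_seqP => m; rewrite !normed_seriesE big_nat_recr//= lerDl.
  exists B => _ [N _ <-]; rewrite normed_seriesE.
  (* The partial sum of the absolute values is [psi] applied to the sign pattern of its own
     coefficients, a function of norm at most 1. *)
  under eq_bigr do rewrite normrEsg mulrC.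
  rewrite -(Omega_step_sum _ N (fun k => Num.sg (psi (Omega_delta k)))).
  apply: le_trans (ler_norm _) (le_trans (psiB _) _).
  rewrite ler_piMr//.
  apply: cont_Omega_norm_le => k; rewrite Omega_step_pt mxE; case: ifP => _.
    by rewrite normr_sg; case: eqP.
  by rewrite normr0.
pose a : l1 R := exist (fun s => s \in @summable_pred R) _ sa.
pose chi : {linear C -> R} := psi \- Omega_pair a.
have chiE f : chi f = psi f - Omega_pair a f by [].
have chiB f : `|chi f| <= (B + `|a|) * `|f|.
  by rewrite chiE (le_trans (ler_normB _ _))// mulrDl lerD// Omega_pair_le.
(* [chi] kills the finitely supported functions, hence only sees the limits of
   [f] along the columns. *)
have chi_step0 N c : chi (Omega_step N c 0) = 0.
  rewrite Omega_step_sum big1// => k _.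
  rewrite chiE /Omega_pair (@l1_pair_single _ _ _ k) => [|j jk].
    by rewrite Omega_step_pt ltnSn eqxx mulr1 subrr mul0r.
  by rewrite Omega_step_pt mxE (negbTE jk); case: ifP; rewrite mulr0.
(* The two functions differ only at the first [N] isolated points. *)
have chi_step N c w :
    chi (Omega_step N c w) = chi (Omega_tail 0 w).
  have -> : Omega_tail 0 w = Omega_step N (w 0 \o @Omega_col n) w.
    by apply: cont_Omega_eq => k; rewrite !Omega_step_pt if_same.
  by rewrite !(Omega_step_tail N _ w) !linearD !chi_step0.
have chi_lim f :
    chi f = chi (Omega_tail 0 (\row_i f (lm i))).
  have := cvg_comp _ _ (@Omega_step_cvg f)
    (bounded_functional_continuous chiB (x := f)).
  move/cvg_lim => <-//; apply/cvg_lim => //; apply: cvg_near_cst.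
  by apply: nearW => N; exact: chi_step.
(* The weight [b_i] is the value of [chi] on the indicator of the whole column [i], its limit
   included. *)
exists a, (fun i => chi (Omega_tail 0 (delta_mx 0 i))) => f.
apply/eqP; rewrite addrC -subr_eq -chiE; apply/eqP; rewrite chi_lim.
rewrite [X in Omega_tail 0 X]row_sum_delta !linear_sum; apply: eq_bigr => i _.
by rewrite !linearZ mxE.
Qed.

End cont_Omega.

(** * The subspace W: closedness, interpolation, projection and codimension *)

Section subspace.
Variables (R : realType) (n : nat) (x : 'I_n.+1 -> l1 R).
Local Notation C := (C_Omega R n.+1).
Local Notation pt := (Omega_pt R n).
Local Notation lm := (@Omega_lim R n).
Implicit Types (f g : C) (c : nat -> R) (w : 'rV[R]_n.+1).

(** W is the kernel of this map into row vectors, so membership, projection and codimension reduce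
    to solving linear systems. *)
Definition defect f : 'rV[R]_n.+1 := \row_i (f (lm i) - Omega_pair (x i) f).

Lemma defectE f i : defect f 0 i = f (lm i) - Omega_pair (x i) f.
Proof. by rewrite mxE. Qed.

Lemma defect_linear : linear defect.
Proof.
move=> a f g; apply/rowP => i; rewrite !mxE cont_spaceDE cont_spaceZE.
rewrite (Omega_pair_linear (x i) a f g : _ = a * _ + _); ring.
Qed.

HB.instance Definition _ :=
  GRing.isLinear.Build R C 'rV[R]_n.+1 *:%R defect defect_linear.

Definition limit_space : {pred C} := fun f => defect f == 0.

Lemma limit_spaceE f : (f \in limit_space) = (defect f == 0). Proof. by []. Qed.

Lemma limit_spaceP f :
  reflect (forall i, f (lm i) = Omega_pair (x i) f) (f \in limit_space).
Proof.
apply: (iffP eqP) => [/rowP h i|h]; last by apply/rowP => i; rewrite !mxE h subrr.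
by apply/eqP; rewrite -subr_eq0 -defectE h mxE.
Qed.

Lemma limit_space_submod : submod_closed limit_space.
Proof.
split; first by rewrite limit_spaceE linear0.
move=> a f g; rewrite !limit_spaceE => /eqP f0 /eqP g0.
by rewrite linearP /= f0 g0 scaler0 addr0.
Qed.

HB.instance Definition _ :=
  GRing.isSubmodClosed.Build R C limit_space limit_space_submod.

Hypothesis x_ball : forall i, `|x i| <= 1.

Lemma defect_le f i : `|defect f 0 i| <= 2 * `|f|.
Proof.
rewrite defectE (le_trans (ler_normB _ _))// mulr_natl mulr2n.
rewrite lerD//; first exact: sup_norm_ub.
by rewrite (le_trans (Omega_pair_le _ _))// ler_piMl.
Qed.

Lemma closed_limit_space : closed [set` limit_space].
Proof.
have mu_lin i : linear (fun f => defect f 0 i : R).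
  by move=> a f g; rewrite linearP !mxE.
pose mu i : {linear C -> R} := HB.pack (fun f => defect f 0 i : R)
  (GRing.isLinear.Build R C R *:%R _ (mu_lin i)).
have -> : [set` limit_space] = \bigcap_i (mu i @^-1` [set 0]).
  apply/seteqP; split => f /=.
    by rewrite limit_spaceE => /eqP f0 i _; rewrite /mu/= f0 mxE.
  move=> f0; rewrite limit_spaceE; apply/eqP/rowP => i; rewrite [RHS]mxE.
  exact: f0.
apply: closed_bigI => i _; apply: closed_comp; last exact: closed_eq.
by move=> f _; apply: (bounded_functional_continuous (f := mu i) (defect_le^~ i)).
Qed.

(** Here 1/2 is the contraction ratio of the fixed point equation; it yields the factor
    [2 = 1 / (1 - 1/2)] in [step_le]. *)
Definition tail_small N := forall i, l1_tail (x i) N <= 2^-1.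

Lemma near_tail_small : \forall N \near \oo, tail_small N.
Proof.
apply: filter_forall => i.
by apply: (cvgr_le _ (@l1_tail_cvg0 R (x i))); rewrite invr_gt0.
Qed.

Lemma Omega_tail_norm w i : `|w 0 i| <= `|Omega_tail 0 w|.
Proof. by rewrite -(Omega_step_lim 0 (fun=> 0) w i) sup_norm_ub. Qed.

(** A priori estimate with three uses: [m = d = 0] gives injectivity of the linear system, [m = 1]
    and [d = 0] keep interpolating functions in the unit ball, and [m = 0] bounds the inverse of the
    system. *)
Lemma step_le N c w m d : tail_small N -> 0 <= d ->
  (forall k, `|c k| <= m) -> (forall i, `|defect (Omega_step N c w) 0 i| <= d) ->
  forall i, `|w 0 i| <= m + 2 * d.
Proof.
(* [Omega_tail 0 w] is constantly [w_i] on column [i], so [M] is the maximum of the [|w_i|]. *)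
move=> Nx d0 cm wd; set M := `|Omega_tail 0 w|.
have wM i : `|w 0 i| <= M := Omega_tail_norm w i.
have m0 : 0 <= m := le_trans (normr_ge0 _) (cm 0%N).
have [Mm i|mM] := lerP M m.
  by rewrite (le_trans (wM i))// (le_trans Mm)// lerDl mulr_ge0.
(* [w] is within [d] of a fixed point of a contraction of ratio at most 1/2 *)
suff MM : M <= d + m + (M - m) / 2 by move=> i; rewrite (le_trans (wM i))//; lra.
have bd i : `|w 0 i| <= d + m + (M - m) / 2.
  have := wd i; rewrite defectE Omega_step_lim => h.
  have T0 := l1_tail_ge0 (x i) N.
  have h2 : `|Omega_pair (x i) (Omega_step N c w)| <=
      m * (\sum_(0 <= k < N) `|x i k|) + M * l1_tail (x i) N.
    rewrite /Omega_pair; apply: l1_pair_split => k kN; rewrite Omega_step_pt.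
      by rewrite kN; exact: cm.
    by rewrite ltnNge kN /= wM.
  (* Since [|x_i| <= 1], a tail of mass [T] leaves at most [1 - T] for the head, and [h2] gives the
     bound [m + (M - m) * T]. *)
  have S1 : \sum_(0 <= k < N) `|x i k| <= 1 - l1_tail (x i) N.
    by rewrite /l1_tail; have := x_ball i; lra.
  have T1 := Nx i.
  have h3 : `|w 0 i| <= d + `|Omega_pair (x i) (Omega_step N c w)|.
    rewrite -[w 0 i](subrK (Omega_pair (x i) (Omega_step N c w))).
    by rewrite (le_trans (ler_normD _ _))// lerD2r.
  have h4 := ler_wpM2l m0 S1.
  have h5 : (M - m) * l1_tail (x i) N <= (M - m) / 2.
    by rewrite ler_wpM2l// subr_ge0 ltW.
  lra.
by apply: cont_Omega_norm_le => k; rewrite Omega_step_pt ltn0.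
Qed.

Definition tail_mx N := lin1_mx (defect \o Omega_tail N).

Lemma mul_tail_mx N w : w *m tail_mx N = defect (Omega_tail N w).
Proof. exact: mul_rV_lin1. Qed.

(** The matrix is square, so injectivity is enough. *)
Lemma tail_mx_unit N : tail_small N -> tail_mx N \in unitmx.
Proof.
move=> Nx; rewrite -row_free_unit; apply: inj_row_free => w.
rewrite mul_tail_mx => w0; apply/rowP => i; rewrite mxE; apply/eqP.
rewrite -normr_le0; have := @step_le N (fun=> 0) w 0 0 Nx (lexx _).
rewrite mulr0 addr0; apply=> [k|j]; first by rewrite normr0.
by rewrite -/(Omega_tail N w) w0 mxE normr0.
Qed.

Lemma limit_space_interp N c : tail_small N -> (forall k, `|c k| <= 1) ->
  exists f : C, [/\ f \in limit_space, `|f| <= 1 &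
    forall k, (k < N)%N -> f (pt k) = c k].
Proof.
move=> Nx c1.
(* The solution of [defect (Omega_step N c 0) + w *m tail_mx N = 0]. *)
pose w := - (defect (Omega_step N c 0) *m invmx (tail_mx N)).
have fW : defect (Omega_step N c w) = 0.
  rewrite Omega_step_tail linearD /= -mul_tail_mx mulNmx mulmxKV ?tail_mx_unit//.
  by rewrite subrr.
have w1 i : `|w 0 i| <= 1.
  have := @step_le N c w 1 0 Nx (lexx _) c1; rewrite mulr0 addr0; apply => j.
  by rewrite fW mxE normr0.
exists (Omega_step N c w); split.
- exact/eqP.
- by apply: cont_Omega_norm_le => k; rewrite Omega_step_pt; case: ifP.
- by move=> k kN; rewrite Omega_step_pt kN.
Qed.

(** Subtracts the tail function with the same defect as [f]; for [tail_small N] this is the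
    projection onto W along the range of [Omega_tail N]. *)
Definition limit_proj N f := f - Omega_tail N (defect f *m invmx (tail_mx N)).

Lemma limit_proj_linear N : linear (limit_proj N).
Proof.
move=> a f g; rewrite /limit_proj !(linearP, mulmxDl) -scalemxAl linearP.
by rewrite scalerBr opprD addrACA.
Qed.

HB.instance Definition _ N :=
  GRing.isLinear.Build R C C *:%R (limit_proj N) (limit_proj_linear N).

Lemma limit_proj_in N f : tail_small N -> limit_proj N f \in limit_space.
Proof.
move=> Nx; rewrite limit_spaceE linearB /= -mul_tail_mx mulmxKV ?subrr//.
exact: tail_mx_unit.
Qed.

Lemma limit_proj_id N f : f \in limit_space -> limit_proj N f = f.
Proof. by move=> /eqP f0; rewrite /limit_proj f0 mul0mx linear0 subr0. Qed.

(** [5 = 1 + 2 * 2]: [defect] has bound 2 and [step_le] with [m = 0] doubles it. *)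
Lemma limit_proj_le N f : tail_small N -> `|limit_proj N f| <= 5 * `|f|.
Proof.
move=> Nx; rewrite (le_trans (ler_normB _ _))//.
suff : `|Omega_tail N (defect f *m invmx (tail_mx N))| <= 4 * `|f| by lra.
apply: cont_Omega_norm_le => k; rewrite Omega_step_pt.
case: ifP => _; first by rewrite normr0 mulr_ge0.
have -> : 4 * `|f| = 0 + 2 * (2 * `|f|) by ring.
apply: (@step_le N (fun=> 0)) => //; rewrite ?mulr_ge0// => i.
  by rewrite normr0.
by rewrite -/(Omega_tail N _) -mul_tail_mx mulmxKV ?tail_mx_unit ?defect_le.
Qed.

(** Subtracting the tail function of [w] from [f] lands in W exactly when
    [w *m tail_mx N = defect f], which has one solution. *)
Lemma limit_space_codim : has_codim limit_space n.+1.
Proof.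
have [N _ /(_ N (leqnn N)) Nx] := near_tail_small.
exists (fun i => Omega_tail N (delta_mx 0 i)) => f.
have E w : (f - \sum_(i < n.+1) w 0 i *: Omega_tail N (delta_mx 0 i) \in limit_space)
   = (w == defect f *m invmx (tail_mx N)).
  under eq_bigr do rewrite -linearZ.
  rewrite -linear_sum -row_sum_delta limit_spaceE linearB /= -mul_tail_mx subr_eq0.
  by apply/eqP/eqP => ->; rewrite ?(mulmxK, mulmxKV) ?tail_mx_unit.
exists (defect f *m invmx (tail_mx N)); split; first by rewrite E.
by move=> w; rewrite E => /eqP.
Qed.

End subspace.

(** * Limit points of finitely many convergent sequences *)

Lemma hausdorff_separate (T : topologicalType) (s t : T) :
  hausdorff_space T -> s != t ->
  exists A B : set T, [/\ nbhs s A, nbhs t B & A `&` B = set0].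
Proof.
rewrite open_hausdorff => hT /hT[[A B] /= [/set_mem sA /set_mem tB] [oA oB /eqP AB]].
by exists A, B; split=> //; exact: open_nbhs_nbhs.
Qed.

Lemma limit_point_sequences (T : topologicalType) (I : finType)
    (e : I -> nat -> T) (x : I -> T) :
  hausdorff_space T -> (forall i, injective (e i)) ->
  (forall i, e i @ \oo --> x i) ->
  limit_point [set s | exists i j, s = e i j] = range x.
Proof.
move=> hT e_inj ex; apply/seteqP; split=> [t tlim|_ [i _ <-] U xU]; last first.
  have [N _ NU] := ex i _ xU.
  (* A limit point needs a term different from [x i]; if the [N]-th term equals [x i], injectivity
     makes the next one differ. *)
  have [eN|eN] := eqVneq (e i N) (x i); last first.
    by exists (e i N); split=> //; [exists i, N|exact: (NU N (leqnn N))].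
  exists (e i N.+1); split; [|by exists i, N.+1|exact: (NU N.+1 (leqnSn N))].
  by rewrite -eN; apply/eqP => /e_inj/eqP; rewrite gtn_eqF.
apply: contrapT => tx.
have avoid (s : T) : s != t -> \forall r \near t, r != s.
  move=> st; have [A [B [sA tB AB]]] := hausdorff_separate hT st.
  apply: filterS tB => r Br; apply/eqP => rs; rewrite -[False]/(set0 r) -AB.
  by split=> //; rewrite rs; exact: nbhs_singleton.
(* Separation from [x i] keeps the tail of each sequence away from [t], and [avoid] handles the
   finitely many earlier terms. *)
have near_t : \forall r \near t, forall i j, r = e i j -> r = t.
  apply: filter_forall => i.
  have xt : x i != t by apply/eqP => xt; apply: tx; exists i.
  have [A [B [xA tB AB]]] := hausdorff_separate hT xt.
  have [N _ NA] := ex i _ xA.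
  have : \forall r \near t, forall k : 'I_N, e i k != t -> r != e i k.
    apply: filter_forall => k.
    by have [ek|/avoid] := eqVneq (e i k) t; [exact: nearW|exact: filterS].
  apply: filterS2 tB => r Br rk j rj; have [jN|Nj] := ltnP j N.
    have := rk (Ordinal jN); rewrite -rj eqxx /= => h.
    by apply/eqP/negPn/negP => /h.
  exfalso; rewrite -[False]/(set0 r) -AB; split=> //.
  by rewrite rj; exact: NA.
have [y [yt [i [j ye]] /(_ i j ye) yt']] := tlim _ near_t.
by rewrite yt' eqxx in yt.
Qed.

(** * Dual norm and the topology sigma(l_1, V) *)

Lemma dual_le (R : realType) (V : normedModType R) (phi : dual V) v :
  `|phi v| <= `|phi| * `|v|.
Proof.
have [->|v0] := eqVneq v 0.
  by rewrite -(scale0r (0 : V)) dual_scale mul0r normr0 mulr_ge0.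
have nv : 0 < `|v| by rewrite normr_gt0.
rewrite -ler_pdivrMr// mulrC -[X in X * _]ger0_norm ?invr_ge0// -normrM -dual_scale.
by apply: op_norm_ub; rewrite normrZ ger0_norm ?invr_ge0// mulVf// gt_eqF.
Qed.

Section sigma_l1.
Variables (R : realType) (V : normedModType R) (J : l1 R -> dual V).

Lemma sigma_l1_eval_continuous v : continuous (fun a : sigma_l1 J => J a v : R).
Proof.
move=> a; apply: (@cvg_comp _ _ _ (pairing J) (fun h : {ptws V -> R} => h v) _
  (nbhs (pairing J a : {ptws V -> R}))).
  exact: (@initial_continuous (l1 R) {ptws V -> R} (pairing J) a).
exact: (@proj_continuous V (fun=> R) v (pairing J a)).
Qed.

Lemma sigma_l1_cvg (u : nat -> sigma_l1 J) (a : sigma_l1 J) :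
  (forall v, (fun t => J (u t) v : R) @ \oo --> (J a v : R)) -> u @ \oo --> a.
Proof.
move=> uv A [_ [[B oB <-] Ba] BA].
have : pairing J \o u @ \oo --> (pairing J a : {ptws V -> R}).
  by apply/pointwise_cvgP => v; exact: uv.
move=> /(_ B (open_nbhs_nbhs (conj oB Ba))) [N _ NB].
by exists N => // k /NB Bk; exact: (BA (u k) Bk).
Qed.

Lemma sigma_l1_hausdorff : injective J -> hausdorff_space (sigma_l1 J).
Proof.
move=> J_inj a b ab; apply: J_inj; apply: val_inj; apply/funext => v.
apply: (@Rhausdorff R) => A B Aa Bb.
have [c [Ac Bc]] :=
  ab _ _ (sigma_l1_eval_continuous Aa) (sigma_l1_eval_continuous Bb).
by exists (J c v).
Qed.

End sigma_l1.

(** * The identification of the dual of W with l_1 *)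

Section limit_space_dual.
Variables (R : realType) (n : nat) (x : 'I_n.+1 -> l1 R).
Hypothesis x_ball : forall i, `|x i| <= 1.
Local Notation W := (limit_space x : submodClosed (C_Omega R n.+1)).
Local Notation pt := (Omega_pt R n).
Local Notation lm := (@Omega_lim R n).

Lemma l1_dual_subproof (a : l1 R) :
  (fun f : normed_sub W => Omega_pair a (val f)) \in @cont_linear R (normed_sub W).
Proof.
have lin : linear (fun f : normed_sub W => Omega_pair a (val f) : R).
  by move=> b f g; rewrite linearP.
apply/cont_linearP; split=> //.
pose p : {linear normed_sub W -> R} :=
  HB.pack (fun f : normed_sub W => Omega_pair a (val f) : R)
    (GRing.isLinear.Build R (normed_sub W) R *:%R _ lin).
apply: (@bounded_functional_continuous R (normed_sub W) p `|a|) => f.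
exact: Omega_pair_le.
Qed.

Definition l1_dual (a : l1 R) : dual (normed_sub W) :=
  exist (fun h => h \in @cont_linear R (normed_sub W)) _ (l1_dual_subproof a).

Lemma l1_dual_lim i f : l1_dual (x i) f = (val f : C_Omega R n.+1) (lm i).
Proof. by have /limit_spaceP/(_ i) -> := valP f. Qed.

Lemma l1_dual_linear : linear l1_dual.
Proof.
move=> b a a'; apply: val_inj; apply/funext => f.
by rewrite [LHS](Omega_pairDl (b *: a) a') Omega_pairZl.
Qed.

Lemma l1_dual_norm a : `|l1_dual a| = `|a|.
Proof.
apply/eqP; rewrite eq_le; apply/andP; split.
  apply: op_norm_le => f f1; rewrite (le_trans (Omega_pair_le _ _))//.
  by rewrite ler_piMr.
(* Take [f] in the unit ball of W with the signs of [a] as its first [N] values. Its pairing with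
   [a] misses [|a|] by at most twice the tail, as signs and values differ by at most 2. *)
have low : \forall N \near \oo, `|a| - 2 * l1_tail a N <= `|l1_dual a|.
  apply: filterS (near_tail_small x) => N Nx.
  have [|f [fW f1 fE]] := limit_space_interp x_ball (c := Num.sg \o a) Nx.
    by move=> k; rewrite normr_sg; case: eqP.
  have h : `|Omega_pair a f| <= `|l1_dual a| :=
    op_norm_ub (l1_dual a) (v := exist _ f fW) f1.
  have sg_le k : `|Num.sg (a k)| <= 1 by rewrite normr_sg; case: eqP.
  have f_le k : `|f (pt k)| <= 1 := le_trans (sup_norm_ub f (pt k)) f1.
  have diff_le k : `|Num.sg (a k) - f (pt k)| <= 2.
    by rewrite (le_trans (ler_normB _ _))// (natrD _ 1 1) lerD.
  have sgE : (fun k => Num.sg (a k)) =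
      (fun k => Num.sg (a k) - f (pt k)) + (fun k => f (pt k)).
    by apply/funext => k; rewrite /= subrK.
  have := l1_pair_sg a; rewrite sgE (l1_pairDr a diff_le f_le) -/(Omega_pair a f).
  have diff0 k : (k < N)%N -> `|Num.sg (a k) - f (pt k)| <= 0.
    by move=> kN; rewrite fE// subrr normr0.
  have := l1_pair_split a diff0 (fun k _ => diff_le k).
  rewrite mul0r add0r.
  move: h; rewrite !(ler_norml (Omega_pair _ _), ler_norml (l1_pair _ _)).
  move=> /andP[_ h1] /andP[_ h2] h3.
  lra.
have lim : `|a| - 2 * l1_tail a N @[N --> \oo] --> `|a|.
  rewrite -[X in _ --> X]subr0 -[X in _ - X](mulr0 2).
  by apply: cvgB; [exact: cvg_cst|apply: cvgMl_tmp; exact: l1_tail_cvg0].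
exact: (cvgr_to_le lim low).
Qed.

HB.instance Definition _ :=
  GRing.isLinear.Build R (l1 R) (dual (normed_sub W)) *:%R l1_dual l1_dual_linear.

Lemma l1_dual_inj : injective l1_dual.
Proof.
move=> a b ab; apply/eqP; rewrite -subr_eq0 -normr_eq0 -l1_dual_norm.
by rewrite linearB /= ab subrr normr0.
Qed.

Lemma l1_dual_surj phi : exists a, l1_dual a = phi.
Proof.
have [N _ /(_ N (leqnn N)) Nx] := near_tail_small x.
(* Composing [phi] with the projection extends it to all of C(Omega^n). *)
pose Q (f : C_Omega R n.+1) : normed_sub W :=
  exist (fun h => h \in W) _ (limit_proj_in x_ball f Nx).
have psi_lin : linear (phi \o Q : C_Omega R n.+1 -> R).
  move=> b f g; rewrite /= -dual_linear; congr (phi _); apply: val_inj.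
  by rewrite /= linearP.
pose psi : {linear C_Omega R n.+1 -> R} := HB.pack (phi \o Q : C_Omega R n.+1 -> R)
  (GRing.isLinear.Build R (C_Omega R n.+1) R *:%R _ psi_lin).
have [||a [b psiE]] := @cont_Omega_riesz R n psi (`|phi| * 5).
- by rewrite mulr_ge0.
- move=> f; rewrite -mulrA (le_trans (dual_le phi (Q f)))// ler_wpM2l//.
  exact: (limit_proj_le x_ball f Nx).
exists (a + \sum_i b i *: x i); apply: val_inj; apply/funext => f.
have -> : \val phi f = psi (val f).
  congr (phi _); apply: val_inj; rewrite /= limit_proj_id//; exact: valP.
rewrite psiE [LHS]Omega_pairDl Omega_pair_suml; congr (_ + _).
by apply: eq_bigr => i _; rewrite mulrC -l1_dual_lim.
Qed.

Lemma l1_dual_basis k f : l1_dual (l1_basis R k) f = (val f : C_Omega R n.+1) (pt k).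
Proof. exact: Omega_pair_basis. Qed.

(** Tested on [f] in W, the basis vectors of column [i] give the values of [f] at points tending to
    p_i, hence converge to the action of [x i]. *)
Lemma l1_dual_limit_point :
  @limit_point (sigma_l1 l1_dual) (range (@l1_basis R)) = range x.
Proof.
have -> : range (@l1_basis R) = [set s : sigma_l1 l1_dual |
    exists (i : 'I_n.+1) j, s = l1_basis R (Omega_idx i j)].
  apply/seteqP; split=> [_ [k _ <-]|_ [i [j ->]]]; last by exists (Omega_idx i j).
  by exists (Omega_col n k), (k %/ n.+1)%N; rewrite Omega_idx_col.
apply: (limit_point_sequences (T := sigma_l1 l1_dual)
  (e := fun (i : 'I_n.+1) j => l1_basis R (Omega_idx i j))).
- by apply: sigma_l1_hausdorff; exact: l1_dual_inj.
- move=> i j j' /(congr1 (fun a : l1 R => a (Omega_idx i j))).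
  rewrite !l1_basisE eqxx; case: eqP => [jj' _|_ /eqP]; last by rewrite oner_eq0.
  by rewrite -(Omega_idx_div i j) jj' Omega_idx_div.
- move=> i; apply: sigma_l1_cvg => f; rewrite l1_dual_lim.
  under eq_fun do rewrite l1_dual_basis.
  exact: cont_Omega_cvg.
Qed.

End limit_space_dual.

Theorem corollary2p3 (R : realType) (n : nat) (n1 : (1 <= n)%N)
    (x : 'I_n -> l1 R) (x_ball : forall i, `|x i| <= 1) :
  exists W : submodClosed (C_Omega R n),
    [/\ closed [set` W],
        has_codim W n
      & exists (T : {linear dual (normed_sub W) -> l1 R})
               (J : l1 R -> dual (normed_sub W)),
        [/\ forall phi, `|T phi| = `|phi|,
            cancel T J,
            cancel J T
          & @limit_point (sigma_l1 J) (range (@l1_basis R)) = range x]].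
Proof.
case: n n1 x x_ball => [//|n] _ x x_ball.
pose W : submodClosed (C_Omega R n.+1) := limit_space x.
exists W; split.
- exact: closed_limit_space.
- exact: limit_space_codim.
(* [T] is chosen pointwise from surjectivity; its linearity comes from that of the injective map
   [l1_dual x]. *)
pose T phi := sval (cid (l1_dual_surj x_ball phi)).
have TK : cancel T (l1_dual x).
  by move=> phi; exact: (svalP (cid (l1_dual_surj x_ball phi))).
have JK : cancel (l1_dual x) T by move=> a; apply: (l1_dual_inj x_ball); exact: TK.
have T_lin : linear T.
  by move=> b phi psi; apply: (l1_dual_inj x_ball); rewrite linearP /= !TK.
pose Tl : {linear dual (normed_sub W) -> l1 R} :=
  HB.pack T (GRing.isLinear.Build R _ (l1 R) *:%R T T_lin).
exists Tl, (l1_dual x).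
split=> // [phi|]; last exact: (l1_dual_limit_point x_ball).
by rewrite /= -(l1_dual_norm x_ball) TK.
Qed.
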